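(* Let $R$ be a finite Frobenius ring and let $w : R \to \mathbb{C}$ be a bi-invariant weight on $R$. Suppose that for every nonzero right ideal $S \subseteq R$, $$\sum_{aR \subseteq S} w(a)\,\mu(0,aR) \neq 0,$$ where the sum is over the principal right ideals $aR$ of $R$ contained in $S$, and $\mu$ is the Möbius function of the poset of principal right ideals of $R$. Then $w$ has the extension property.
   Context: Rings are associative with $1$, not necessarily commutative. $\mathcal{U}$ denotes the group of units of $R$. $\widehat{R}$ is the group of complex characters $\pi : (R,+) \to \mathbb{C}^\times$, an $R$-bimodule via $({}^s\pi)(r) = \pi(rs)$ and $(\pi^s)(r) = \pi(sr)$. A finite ring $R$ is Frobenius if and only if ${}_RR\cong{}_R\widehat{R}$, equivalently $R_R\cong\widehat{R}_R$. A weight on $R$ is a function $w : R \to \mathbb{C}$ with $w(0)=0$. It is bi-invariant if $w(uav)=w(a)$ for all $a\in R$ and $u,v\in\mathcal{U}$. Let $P=\{aR : a\in R\}$ be the set of all principal right ideals of $R$, partially ordered by inclusion, with Möbius function $\mu$: $\mu(aR,cR)=0$ when $aR\not\subseteq cR$; $\mu(aR,aR)=1$; and $\sum_{aR\subseteq bR\subseteq cR}\mu(aR,bR)=0$ (sum over $bR\in P$) for $aR\subsetneq cR$. It is known that $aR=bR$ if and only if $a\,\mathcal{U}=b\,\mathcal{U}$, so for bi-invariant $w$ the value $w(a)$ depends only on $aR$. The weight is extended to $R^n$ by $w(x)=\sum_{i=1}^n w(x_i)$. A linear code of length $n$ is a left $R$-submodule $C\subseteq R^n$. A $w$-isometry is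 an injective left $R$-linear homomorphism $f:C\to R^n$ with $w(f(x))=w(x)$ for all $x\in C$. A monomial transformation of $R^n$ is a map $T:R^n\to R^n$ of the form $T(x_1,\dots,x_n)=(x_{\sigma(1)}u_1,\dots,x_{\sigma(n)}u_n)$ with $u_1,\dots,u_n\in\mathcal{U}$ and $\sigma$ a permutation of $\{1,\dots,n\}$. A bi-invariant weight $w$ on $R$ has the extension property if for every $n$, every linear code $C\subseteq R^n$ and every $w$-isometry $f:C\to R^n$, the map $f$ extends to a monomial transformation of $R^n$. *)

(* Defs.v *)
From HB Require Import structures.
From mathcomp Require Import all_boot all_order all_fingroup all_algebra.
From mathcomp Require Import reals.
From mathcomp Require Import complex.
Set Implicit Arguments.
Unset Strict Implicit.
Unset Printing Implicit Defensive.
Import Order.TTheory GRing.Theory Num.Theory.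
Local Open Scope ring_scope.

(* Rings are [finPzRingType]: the trivial ring is not excluded.  MathComp's
   [GRing.unit] is only available on nontrivial rings, hence [is_unit]. *)
Definition is_unit (R : finPzRingType) (u : R) : Prop :=
  exists v : R, u * v = 1 /\ v * u = 1.

Section Characters.
Variables (K : realType) (R : finPzRingType).

(* The field of complex numbers is [complex K], for K a model of the reals. *)
Definition is_character (f : {ffun R -> complex K}) : bool :=
  [forall x, f x != 0] && [forall x, forall y, f (x + y) == f x * f y].

Record char_dual := CharDual { char_val :> {ffun R -> complex K}; _ : is_character char_val }.

HB.instance Definition _ := [isSub for char_val].
HB.instance Definition _ := [Choice of char_dual by <:].

Lemma char_neq0 (p : char_dual) x : p x != 0.
Proof. by case: p => f /= /andP[/forallP]. Qed.

Lemma charD (p : char_dual) x y : p (x + y) = p x * p y.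
Proof. by case: p => f /= /andP[_ /forallP/(_ x)/forallP/(_ y)/eqP]. Qed.

Lemma dual_eqP (p q : char_dual) : (forall x, p x = q x) -> p = q.
Proof. by move=> pq; apply/val_inj/ffunP. Qed.

Fact dual_one_subproof : is_character [ffun=> 1].
Proof.
apply/andP; split; apply/forallP=> x; first by rewrite ffunE oner_neq0.
by apply/forallP=> y; rewrite !ffunE mulr1.
Qed.
Definition dual_one := CharDual dual_one_subproof.

Fact dual_mul_subproof (p q : char_dual) : is_character [ffun x => p x * q x].
Proof.
apply/andP; split; apply/forallP=> x.
  by rewrite ffunE mulf_neq0 ?char_neq0.
by apply/forallP=> y; rewrite !ffunE !charD mulrACA.
Qed.
Definition dual_mul p q := CharDual (dual_mul_subproof p q).

Fact dual_inv_subproof (p : char_dual) : is_character [ffun x => (p x)^-1].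
Proof.
apply/andP; split; apply/forallP=> x; first by rewrite ffunE invr_neq0 ?char_neq0.
by apply/forallP=> y; rewrite !ffunE charD invfM.
Qed.
Definition dual_inv p := CharDual (dual_inv_subproof p).

Fact dual_scale_subproof (s : R) (p : char_dual) : is_character [ffun r => p (r * s)].
Proof.
apply/andP; split; apply/forallP=> x; first by rewrite ffunE char_neq0.
by apply/forallP=> y; rewrite !ffunE mulrDl charD.
Qed.
Definition dual_scale s p := CharDual (dual_scale_subproof s p).

Fact dual_mulA : associative dual_mul.
Proof. by move=> p q r; apply: dual_eqP => x; rewrite !ffunE mulrA. Qed.
Fact dual_mulC : commutative dual_mul.
Proof. by move=> p q; apply: dual_eqP => x; rewrite !ffunE mulrC. Qed.
Fact dual_mul1 : left_id dual_one dual_mul.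
Proof. by move=> p; apply: dual_eqP => x; rewrite !ffunE mul1r. Qed.
Fact dual_mulV : left_inverse dual_one dual_inv dual_mul.
Proof. by move=> p; apply: dual_eqP => x; rewrite !ffunE mulVf ?char_neq0. Qed.

(* The pointwise product of characters is the addition of the Z-module. *)
HB.instance Definition _ :=
  GRing.isZmodule.Build char_dual dual_mulA dual_mulC dual_mul1 dual_mulV.

Fact dual_scaleA s t p : dual_scale s (dual_scale t p) = dual_scale (s * t) p.
Proof. by apply: dual_eqP => x; rewrite !ffunE mulrA. Qed.
Fact dual_scale1 : left_id 1 dual_scale.
Proof. by move=> p; apply: dual_eqP => x; rewrite !ffunE mulr1. Qed.
Fact dual_scaleDr : right_distributive dual_scale +%R.
Proof. by move=> s p q; apply: dual_eqP => x; rewrite !ffunE. Qed.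
Fact dual_scaleDl p : {morph dual_scale^~ p : s t / s + t}.
Proof. by move=> s t; apply: dual_eqP => x; rewrite !ffunE mulrDr charD. Qed.

HB.instance Definition _ := GRing.Zmodule_isLmodule.Build R char_dual
  dual_scaleA dual_scale1 dual_scaleDr dual_scaleDl.

Lemma dual_addE (p q : char_dual) x : (p + q) x = p x * q x.
Proof. by rewrite ffunE. Qed.

Lemma dual_scaleE (s : R) (p : char_dual) x : (s *: p) x = p (x * s).
Proof. by rewrite ffunE. Qed.

(* R and its character module are isomorphic as left R-modules. *)
Definition frobenius : Prop :=
  exists phi : {linear R^o -> char_dual}, bijective phi.

End Characters.

Section Moebius.
Variables (T : finType) (P : {set {set T}}).
Implicit Types A B C : {set T}.

Fixpoint moebius_rec (n : nat) A C : int :=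
  if A == C then 1
  else if n isn't n'.+1 then 0
  else if A \subset C
       then - \sum_(B in P | (A \subset B) && (B \proper C)) moebius_rec n' A B
       else 0.

(* Moebius function of the family P ordered by inclusion.  It is meaningful for
   A, C in P; the recursion lowers the cardinal of C, so #|C| steps suffice. *)
Definition moebius A C : int := moebius_rec #|C| A C.

Lemma moebius_rec_fuel n A C : (#|C| <= n)%N -> moebius_rec n A C = moebius A C.
Proof.
rewrite /moebius; have [m] := ubnP #|C|.
elim: m n C => // m IH n C ltCm leCn.
case: (eqVneq A C) => [->|neqAC].
  by case: n leCn => [|n] _; case: #|C| => [|k] /=; rewrite eqxx.
case C0: #|C| => [|k].
  have -> : C = set0 by apply/eqP; rewrite -cards_eq0 C0.
  case: n {leCn} => [|n] //=; case: (eqVneq A set0) => // nA0.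
  by rewrite subset0 (negPf nA0).
case: n leCn => [|n leCn /=]; first by rewrite C0.
rewrite (negPf neqAC); case: ifP => // _; congr (- _).
apply: eq_bigr => B /andP[_ /andP[_ /proper_card ltBC]].
have ltBm : (#|B| < m)%N by apply: leq_trans ltBC _.
by rewrite !(IH _ B) //; rewrite -ltnS ?(leq_trans ltBC) // -C0.
Qed.

Lemma moebius_nsub A C : ~~ (A \subset C) -> moebius A C = 0.
Proof.
move=> nAC; have neqAC : A != C by apply: contraNneq nAC => ->.
by rewrite /moebius; case: #|C| => [|k] /=; rewrite (negPf neqAC) ?(negPf nAC).
Qed.

Lemma moebius_refl A : moebius A A = 1.
Proof. by rewrite /moebius; case: #|A| => [|k] /=; rewrite eqxx. Qed.

Lemma moebius_sum A C : C \in P -> A \proper C ->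
  \sum_(B in P | (A \subset B) && (B \subset C)) moebius A B = 0.
Proof.
move=> PC ltAC; rewrite (bigD1 C) /=; last by rewrite PC subxx proper_sub.
rewrite -(@moebius_rec_fuel #|C|.+1) //= (negPf (proper_neq ltAC)) proper_sub //.
apply/eqP; rewrite addrC subr_eq0; apply/eqP.
rewrite [RHS](eq_bigr (moebius A)) => [|B /andP[_ /andP[_ ltBC]]]; last first.
  by rewrite moebius_rec_fuel // ltnW // proper_card.
by apply: eq_bigl => B; rewrite properEneq -!andbA [(B != C) && _]andbC.
Qed.

End Moebius.

Section Ideals.
Variable R : finPzRingType.

Definition principal (a : R) : {set R} := [set a * r | r : R].

Definition principals : {set {set R}} := [set principal a | a : R].

Definition right_ideal (S : {set R}) : Prop :=
  zmod_closed S /\ (forall x r : R, x \in S -> x * r \in S).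

End Ideals.

Section Weights.
Variables (K : realType) (R : finPzRingType).
Implicit Type w : R -> complex K.

Definition is_weight w : Prop := w 0 = 0.

Definition bi_invariant w : Prop :=
  forall u a v : R, is_unit u -> is_unit v -> w (u * a * v) = w a.

(* Value of w at an arbitrarily chosen generator of A; for a bi-invariant w it
   does not depend on that choice. *)
Definition ideal_weight w (A : {set R}) : complex K :=
  if [pick a | principal a == A] is Some a then w a else 0.

Definition weight n w (x : 'rV[R]_n) : complex K := \sum_(i < n) w (x 0 i).

(* Codes and isometries live in total functions: f is only constrained on C. *)
Definition isometry n w (C : {set 'rV[R]_n}) (f : 'rV[R]_n -> 'rV[R]_n) : Prop :=
  [/\ forall (a : R) (x y : 'rV[R]_n), x \in C -> y \in C ->
        f (a *: x + y) = a *: f x + f y,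
      {in C &, injective f}
    & forall x, x \in C -> weight w (f x) = weight w x].

Definition monomial n (T : 'rV[R]_n -> 'rV[R]_n) : Prop :=
  exists (s : 'S_n) (u : 'I_n -> R),
    (forall i, is_unit (u i)) /\
    (forall x, T x = \row_i (x 0 (s i) * u i)).

Definition extension_property w : Prop :=
  forall (n : nat) (C : {set 'rV[R]_n}) (f : 'rV[R]_n -> 'rV[R]_n),
    submod_closed C -> isometry w C f ->
    exists T : 'rV[R]_n -> 'rV[R]_n, monomial T /\ {in C, f =1 T}.

End Weights.

(* Main.v *)
From HB Require Import structures.
Require Import Defs.
From mathcomp Require Import all_boot all_order all_fingroup all_algebra.
From mathcomp Require Import reals complex.
Set Implicit Arguments.
Unset Strict Implicit.
Unset Printing Implicit Defensive.
Import GRing.Theory Num.Theory.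
Local Open Scope ring_scope.

(** A Frobenius ring has a generating character [chi]: the pairing
    [(r, s) |-> chi (r * s)] is nondegenerate, so all characters of [R] are
    [chi (_ * s)], and also all are [chi (r * _)].  Comparing both descriptions
    gives the Nakayama map [tau], with [chi (a * x) = chi (x * tau a)].

    Let [f] be a [w]-isometry on a code [C], and call [x i] and [y i] the
    coordinates of a codeword and of its image.  For all scalars [r],
    [\sum_i w (r * x i) = \sum_i w (r * y i)].  The heart of the proof is that
    this linear system determines more than it says: it implies
      [\sum_i \sum_u chi (x i * u) = \sum_i \sum_u chi (y i * u)]
    where [u] runs over the units ([unit_char_sums_eq]).  Indeed, after a
    Fourier expansion of [w] the system is triangular with respect to inclusion
    of principal left ideals ([left_convolution_inj]).  Its diagonal entry at
    [s] is a sum of Fourier coefficients over a coset of the left annihilator of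
    [s]; by Poisson summation it is a nonzero multiple of the sum of
    [w r * chi (- r)] over a nonzero right ideal [S] ([sum_fourier_coset]).  Since
    the values of [chi] at the generators of a principal right ideal add up to a
    Moebius value ([sum_generators_moebius]), this is the sum which the
    hypothesis on [w] assumes to be nonzero.

    The identity between sums of [chi] is an equality of two sums of characters
    of the group [C].  Characters are linearly independent and [chi] separates
    linear functionals, so the functionals [x i * u] and [y i * u] form the same
    multiset.  Hence every orbit of functionals under the units contains as many
    coordinates of the codewords as of their images, and matching them orbit by
    orbit gives the monomial transformation ([linear_extension]).

    Both the triangularity and the Moebius formula need that two generators of
    a one-sided principal ideal of a finite ring differ by a unit
    ([same_principal_unit]), for which a counting proof is given. *)

(** * Generators of principal ideals of finite rings *)

Section UnitsOfFiniteRings.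

(** The up-set counts of [r] determine its fibre counts: this is Moebius
    inversion over the sets ordered by inclusion, done by descending induction. *)
Lemma eq_card_fibers (T I : finType) (r : T -> {set I}) (Y Z : {set T}) :
    (forall K : {set I},
      #|[set z in Y | K \subset r z]| = #|[set z in Z | K \subset r z]|) ->
  forall K : {set I}, #|[set z in Y | r z == K]| = #|[set z in Z | r z == K]|.
Proof.
move=> eqYZ K; have [m] := ubnP #|~: K|.
elim: m K => // m IHm K ltKm.
have split_fibers (X : {set T}) : #|[set z in X | K \subset r z]| =
    (#|[set z in X | r z == K]| +
      \sum_(J : {set I} | K \proper J) #|[set z in X | r z == J]|)%N.
  rewrite -sum1_card (partition_big r (fun J => K \subset J)) /=; last first.
    by move=> z; rewrite inE => /andP[].
  rewrite (bigD1 K) //=; congr (_ + _)%N.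
    rewrite -sum1_card; apply: eq_bigl => z; rewrite !inE -andbA.
    by case: eqP => [->|]; rewrite ?subxx ?andbF.
  apply: eq_big => [J|J /andP[sKJ _]]; first by rewrite properEneq eq_sym andbC.
  rewrite -sum1_card; apply: eq_bigl => z; rewrite !inE -andbA.
  by case: eqP => [->|]; rewrite ?sKJ ?andbF.
have := eqYZ K; rewrite !split_fibers.
rewrite (eq_bigr (fun J : {set I} => #|[set z in Z | r z == J]|)); last first.
  move=> J ltKJ; apply: IHm; rewrite -ltnS; apply: leq_trans ltKm.
  by rewrite ltnS proper_card // properC.
by move/addIn.
Qed.

Variable R : finPzRingType.

(** A boolean form of [is_unit], so that units can be summed over. *)
Definition ring_units : {set R} :=
  [set u | [exists v, (u * v == 1) && (v * u == 1)]].

Lemma ring_unitsP (u : R) : reflect (is_unit u) (u \in ring_units).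
Proof.
rewrite inE; apply: (iffP existsP) => -[v].
  by case/andP=> /eqP uv /eqP vu; exists v.
by case=> uv vu; exists v; rewrite uv vu !eqxx.
Qed.

Lemma is_unit1 : is_unit (1 : R).
Proof. by exists 1; rewrite mulr1. Qed.

Lemma is_unitM (u v : R) : is_unit u -> is_unit v -> is_unit (u * v).
Proof.
move=> [u' [uu' u'u]] [v' [vv' v'v]]; exists (v' * u').
by rewrite mulrA -(mulrA u) vv' mulr1 uu' mulrA -(mulrA v') u'u mulr1 v'v.
Qed.

Lemma ring_unitsM (u v : R) :
  u \in ring_units -> v \in ring_units -> u * v \in ring_units.
Proof. by move=> /ring_unitsP Uu /ring_unitsP Uv; apply/ring_unitsP/is_unitM. Qed.

Lemma ring_units1 : 1 \in ring_units.
Proof. exact/ring_unitsP/is_unit1. Qed.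

(** Left multiplication by [z] is a self-map of a finite set, hence bijective as
    soon as it is injective. *)
Lemma mulr_inj_unit (z : R) : (forall y, z * y = 0 -> y = 0) -> is_unit z.
Proof.
move=> z0; have z_inj : injective (fun y => z * y).
  by move=> x y /= /eqP; rewrite -subr_eq0 -mulrBr => /eqP/z0/subr0_eq.
have [g _ gK] := injF_bij z_inj; exists (g 1); have /= zg := gK 1.
by split=> //; apply: z_inj; rewrite /= mulrA zg mul1r mulr1.
Qed.

(** The right annihilator of [z]. *)
Definition rann (z : R) : {set R} := [set y | z * y == 0].

Lemma sub_rannP (K : {set R}) z :
  reflect (forall k, k \in K -> z * k = 0) (K \subset rann z).
Proof.
apply: (iffP subsetP) => zK k /zK; first by rewrite inE => /eqP.
by rewrite inE => ->.
Qed.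
Arguments sub_rannP {K z}.

Lemma card_mulr_image (a : R) (L : {set R}) : zmod_closed L ->
  (#|[set (a * z)%R | z in L]| * #|[set z in L | (a * z == 0)%R]|)%N = #|L|.
Proof.
move=> [L0 LB]; have LN x : x \in L -> - x \in L by rewrite -sub0r; apply: LB.
have LD x y : x \in L -> y \in L -> x + y \in L.
  by move=> Lx Ly; rewrite -(opprK y); apply/LB/LN.
rewrite -[RHS]sum1_card.
rewrite (partition_big (fun z => a * z) (mem [set a * z | z in L])) /=; last first.
  by move=> z; apply: imset_f.
rewrite -sum_nat_const; apply: eq_bigr => _ /imsetP[z0 Lz0 ->].
rewrite sum1_card -(card_imset _ (addrI z0)); apply: eq_card => z.
apply/imsetP/idP => [[y]|/andP[Lz /eqP azz0]].
  rewrite !inE => /andP[Ly /eqP ay0] ->.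
  by rewrite unfold_in /= LD //= mulrDr ay0 addr0.
by exists (z - z0); rewrite ?subrKC // !inE LB //= mulrBr azz0 subrr.
Qed.

(** Among the solutions [z] of [b * z = a] one has to find a unit, that is, one
    with trivial right annihilator.  The solutions of [a * z = a] include the
    unit [1], so it is enough that both equations have as many solutions with a
    given annihilator, and for this that they have as many solutions killing
    any given set [K].  The elements killing [K] form a left ideal [L], and the
    solutions in [L] of either equation, if there are any, form a coset of the
    kernel of left multiplication by [b], respectively [a], on [L].  These
    kernels have the same size, because [b * L = a * L]. *)
Lemma same_principal_unit (a b x y : R) : a = b * x -> b = a * y ->
  exists2 u, is_unit u & a = b * u.
Proof.
move=> abx bay.
have annP (K : {set R}) z : zmod_closed [set z : R | K \subset rann z] /\
    (K \subset rann z -> forall t, K \subset rann (t * z)).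
  split=> [|/sub_rannP zK t]; last first.
    by apply/sub_rannP => k /zK; rewrite -mulrA => ->; rewrite mulr0.
  split=> [|z1 z2]; first by rewrite inE; apply/sub_rannP => k _; rewrite mul0r.
  rewrite !inE => /sub_rannP h1 /sub_rannP h2; apply/sub_rannP=> k Kk.
  by rewrite mulrBl h1 // h2 // subrr.
pose sols c := [set z : R | c * z == a].
have card_sols c z0 (K : {set R}) : c * z0 = a -> K \subset rann z0 ->
    #|[set z in sols c | K \subset rann z]| =
    #|[set z in [set z | K \subset rann z] | c * z == 0]|.
  move=> cz0 Kz0; have [[_ LB] _] := annP K 0.
  rewrite -[RHS](card_imset _ (addrI z0)); apply: eq_card => z.
  apply/idP/imsetP => [|[t]].
    rewrite !inE => /andP[/eqP cz Kz]; exists (z - z0); last by rewrite subrKC.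
    have := LB z z0; rewrite !inE => -> //.
    by rewrite mulrBr cz cz0 subrr eqxx.
  rewrite !inE => /andP[Kt /eqP ct] ->.
  rewrite mulrDr cz0 ct addr0 eqxx /=; apply/sub_rannP => k Kk.
  by rewrite mulrDl (sub_rannP Kz0) // (sub_rannP Kt) // addr0.
have eqK (K : {set R}) : #|[set z in sols b | K \subset rann z]| =
             #|[set z in sols a | K \subset rann z]|.
  have [/existsP[z1 /andP[/eqP az1 Kz1]]|noz] :=
      boolP [exists z, (a * z == a) && (K \subset rann z)]; last first.
    rewrite !(eq_card0 (A := [set _ in _ | _])) // => z; rewrite !inE.
      by apply: contraNF noz => az; apply/existsP; exists z.
    apply: contraNF noz => /andP[/eqP bz Kz]; apply/existsP; exists (y * z).
    by rewrite mulrA -bay bz eqxx (annP K z).2.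
  have bxz1 : b * (x * z1) = a by rewrite mulrA -abx az1.
  have [Lz LM] := annP K z1.
  rewrite (card_sols a z1) // (card_sols b (x * z1)) //; last exact: LM.
  have eq_im : [set b * z | z in [set z | K \subset rann z]] =
               [set a * z | z in [set z | K \subset rann z]].
    apply/setP=> t; apply/imsetP/imsetP=> -[z]; rewrite inE => Kz ->.
      by exists (y * z); rewrite ?inE ?(annP K z).2 // mulrA -bay.
    by exists (x * z); rewrite ?inE ?(annP K z).2 // mulrA -abx.
  have im0 : (0 < #|[set (a * z)%R | z in [set z | K \subset rann z]]|)%N.
    by apply/card_gt0P; exists (a * z1); apply: imset_f; rewrite inE.
  have := card_mulr_image b Lz.
  by rewrite -(card_mulr_image a Lz) eq_im => /eqP; rewrite eqn_pmul2l // => /eqP.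
have sol1 : (0 < #|[set z in sols a | rann z == [set 0%R]]|)%N.
  apply/card_gt0P; exists 1; rewrite !inE mulr1 eqxx /=.
  by apply/eqP/setP=> z; rewrite !inE mul1r.
move: sol1; rewrite -(eq_card_fibers eqK) => /card_gt0P[u].
rewrite !inE => /andP[/eqP bu /eqP ru]; exists u => //.
by apply: mulr_inj_unit => z uz; apply/set1P; rewrite -ru inE uz.
Qed.

End UnitsOfFiniteRings.

(* The converse of a finite ring is finite; this transfers statements on right
   ideals to left ideals. *)
HB.instance Definition _ (T : countType) := Countable.copy T^c T.
HB.instance Definition _ (T : finType) := Finite.copy T^c T.
HB.instance Definition _ (R : finPzRingType) := FinRing.PzRing.on R^c.

Lemma same_left_principal_unit (R : finPzRingType) (a b x y : R) :
  a = x * b -> b = y * a -> exists2 u, is_unit u & a = u * b.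
Proof.
move=> axb bya; have [] := @same_principal_unit R^c a b x y axb bya.
by move=> u [v [uv vu]] au; exists u => //; exists v.
Qed.

(** * Generating characters and Fourier inversion *)

Section GeneratingCharacters.
Variable F : numFieldType.

(** Orthogonality: translating by an [a] with [psi a != 1] multiplies the sum by
    [psi a] and permutes its terms. *)
Lemma sum_additive_char (V : finZmodType) (A : {set V}) (psi : V -> F) :
    zmod_closed A -> {in A &, {morph psi : x y / x + y >-> x * y}} ->
    psi 0 = 1 ->
  \sum_(x in A) psi x = if [forall x in A, psi x == 1] then #|A|%:R else 0.
Proof.
move=> [A0 AB] psiD psi0; have AN x : x \in A -> - x \in A.
  by rewrite -sub0r; apply: AB.
have AD x y : x \in A -> y \in A -> x + y \in A.
  by move=> Ax Ay; rewrite -(opprK y); apply/AB/AN.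
case: ifPn => [/forall_inP psi1|].
  by rewrite (eq_bigr (fun=> 1)) ?sumr_const // => x /psi1/eqP.
rewrite negb_forall_in => /exists_inP[a Aa psi_a].
suff /eqP : (psi a - 1) * (\sum_(x in A) psi x) = 0.
  by rewrite mulf_eq0 subr_eq0 (negPf psi_a) => /eqP.
apply/eqP; rewrite mulrBl mul1r subr_eq0.
rewrite [X in _ == X](reindex_inj (addrI a)) /= mulr_sumr; apply/eqP.
apply: eq_big => [x|x Ax]; last by rewrite psiD.
by apply/idP/idP => [Ax|Aax]; [apply: AD | rewrite -(addKr a x) AD // AN].
Qed.

Lemma sum_additive_charT (V : finZmodType) (psi : V -> F) :
    {morph psi : x y / x + y >-> x * y} -> psi 0 = 1 ->
  \sum_x psi x = if [forall x, psi x == 1] then #|V|%:R else 0.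
Proof.
move=> psiD psi0; have := @sum_additive_char V setT psi.
rewrite cardsT (eq_bigl xpredT) => [|x]; last by rewrite inE.
move=> -> //.
  by congr (if _ then _ else _); apply: eq_forallb => x; rewrite inE.
by split=> [|x y _ _]; rewrite inE.
Qed.

Variables (R : finPzRingType) (chi : R -> F).

(** The third clause says that no two characters [chi (_ * s)] coincide; the
    fourth is the part of their exhausting all characters that gives the
    Nakayama map. *)
Definition generating_character : Prop :=
  [/\ chi 0 = 1, {morph chi : x y / x + y >-> x * y},
      forall s, (forall r, chi (r * s) = 1) -> s = 0
    & forall a, exists b, forall x, chi (a * x) = chi (x * b)].

Hypothesis chi_gen : generating_character.

Let chi0 : chi 0 = 1. Proof. by case: chi_gen. Qed.
Let chiD : {morph chi : x y / x + y >-> x * y}. Proof. by case: chi_gen. Qed.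
Let chi_nd : forall s, (forall r, chi (r * s) = 1) -> s = 0.
Proof. by case: chi_gen. Qed.

Lemma card_ring_neq0 : #|R|%:R != 0 :> F.
Proof. by rewrite pnatr_eq0 -lt0n; apply/card_gt0P; exists 0. Qed.

Lemma sum_char_col (s : R) : \sum_r chi (r * s) = if s == 0 then #|R|%:R else 0.
Proof.
rewrite (sum_additive_charT (psi := fun r => chi (r * s))) ?mul0r // => [|x y];
  last by rewrite mulrDl chiD.
congr (if _ then _ else _); apply/forallP/eqP => [chi1|-> x].
  by apply: chi_nd => r; apply/eqP.
by rewrite mulr0 chi0.
Qed.

(** Summing [chi (r * s)] over all [r] and [s] in both orders gives [#|R|], from
    the nondegeneracy on one side, and [#|R|] times the size of the radical on
    the other side, which is therefore trivial. *)
Lemma right_nondegenerate (r : R) : (forall s, chi (r * s) = 1) -> r = 0.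
Proof.
have sum_row x : \sum_s chi (x * s) =
    if [forall s, chi (x * s) == 1] then #|R|%:R else 0.
  rewrite (sum_additive_charT (psi := fun s => chi (x * s))) ?mulr0 // => y z.
  by rewrite mulrDr chiD.
pose N := [set x | [forall s, chi (x * s) == 1]].
have cardN : #|N| = 1%N.
  have : \sum_x \sum_s chi (x * s) = #|R|%:R.
    rewrite exchange_big /= (bigD1 0) //= sum_char_col eqxx big1 ?addr0 // => s.
    by rewrite sum_char_col => /negPf->.
  rewrite (eq_bigr _ (fun x _ => sum_row x)) -big_mkcond /=.
  rewrite (eq_bigl (fun x => x \in N)) => [|x]; last by rewrite inE.
  rewrite sumr_const -mulrnA => /eqP; rewrite eqr_nat -[X in _ == X]muln1.
  rewrite eqn_pmul2l; first by move/eqP.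
  by apply/card_gt0P; exists 0.
move=> chi1; have /cards1P[z Nz] : #|N| == 1%N by rewrite cardN.
have : 0 \in N by rewrite inE; apply/forallP=> s; rewrite mul0r chi0.
have : r \in N by rewrite inE; apply/forallP=> s; rewrite chi1.
by rewrite Nz !inE => /eqP-> /eqP.
Qed.

Lemma sum_char_row (r : R) : \sum_s chi (r * s) = if r == 0 then #|R|%:R else 0.
Proof.
rewrite (sum_additive_charT (psi := fun s => chi (r * s))) ?mulr0 // => [|x y];
  last by rewrite mulrDr chiD.
congr (if _ then _ else _); apply/forallP/eqP => [chi1|-> x].
  by apply: right_nondegenerate => s; apply/eqP.
by rewrite mul0r chi0.
Qed.

(** Injectivity of [tau] is the nondegeneracy of the pairing on the left. *)
Lemma nakayama_bij :
  exists2 tau : R -> R, bijective tau & forall a x, chi (a * x) = chi (x * tau a).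
Proof.
have /fin_all_exists[tau tauE] :
    forall a, exists b, forall x, chi (a * x) = chi (x * b).
  by case: chi_gen.
exists tau => //; apply: injF_bij => a b eq_ab.
apply/subr0_eq/right_nondegenerate => x.
by rewrite mulrBl chiD tauE eq_ab -tauE -chiD subrr.
Qed.

Definition fourier (w : R -> F) (t : R) : F :=
  #|R|%:R^-1 * \sum_r w r * chi (- (r * t)).

Lemma fourier_inversion w r : w r = \sum_t fourier w t * chi (r * t).
Proof.
under eq_bigr => t _ do rewrite /fourier -mulrA mulr_suml mulr_sumr.
rewrite exchange_big /= (bigD1 r) //= [X in _ + X]big1 => [|s /negPf neq_sr].
  rewrite addr0 (eq_bigr (fun=> #|R|%:R^-1 * w r)) => [|t _].
    by rewrite sumr_const -[RHS]mulr_natr mulrAC mulVf ?card_ring_neq0 ?mul1r.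
  by rewrite -mulrA -chiD addNr chi0 mulr1.
under eq_bigr => t _ do rewrite -mulrA -chiD addrC -mulrBl.
rewrite -!mulr_sumr sum_char_row subr_eq0 eq_sym neq_sr.
by rewrite !mulr0.
Qed.
End GeneratingCharacters.

(** * Invertibility of the system attached to the weight *)

Section LeftConvolution.
Variables (F : numFieldType) (R : finPzRingType).

(** By induction on the left ideal [R s].  In [\sum_t h t * E (t * s)] the terms
    with [R t s] smaller than [R s] vanish by induction; in the others [t * s] is
    a unit multiple of [s], so that [E (t * s) = E s].  What remains is [E s]
    times the sum of [h] over the [t] such that [t * s] is in the unit orbit of
    [s], and the left invariance of [h] makes this sum a multiple of the sum over
    the [t] with [t * s = s]. *)
Lemma left_convolution_inj (h E : R -> F) :
    (forall u t, is_unit u -> h (u * t) = h t) ->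
    (forall u t, is_unit u -> E (u * t) = E t) ->
    E 0 = 0 ->
    (forall s, s != 0 -> \sum_(t | t * s == s) h t != 0) ->
    (forall s, \sum_t h t * E (t * s) = 0) ->
  forall s, E s = 0.
Proof.
move=> hU EU E0 h_n0 hE s; pose ideal (x : R) := [set t * x | t : R].
have [m] := ubnP #|ideal s|; elim: m s => // m IHm s lt_sm.
have [->|s_n0] := eqVneq s 0; first exact: E0.
pose orbit := [set u * s | u in ring_units R].
have E_orbit t : h t * E (t * s) = if t * s \in orbit then h t * E s else 0.
  case: ifPn => [/imsetP[u /ring_unitsP Uu ->]|ts_out]; first by rewrite EU.
  rewrite IHm ?mulr0 // -ltnS; apply: leq_trans lt_sm; rewrite ltnS proper_card //.
  rewrite properE; apply/andP; split.
    apply/subsetP=> _ /imsetP[x _ ->].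
    by apply/imsetP; exists (x * t); rewrite ?mulrA.
  apply: contra ts_out => /subsetP sub_ideal.
  have /sub_ideal/imsetP[x _ sE] : s \in ideal s.
    by apply/imsetP; exists 1; rewrite ?mul1r.
  have [u Uu tsE] := same_left_principal_unit (erefl (t * s)) sE.
  by apply/imsetP; exists u => //; apply/ring_unitsP.
have := hE s; rewrite (eq_bigr _ (fun t _ => E_orbit t)) -big_mkcond /= -mulr_suml.
move/eqP; rewrite mulf_eq0 => /orP[|/eqP//].
rewrite (partition_big (fun t => t * s) (fun v => v \in orbit)) //=.
rewrite (eq_bigr (fun=> \sum_(t | t * s == s) h t)).
  rewrite sumr_const -mulr_natr mulf_eq0 (negPf (h_n0 s s_n0)) /= pnatr_eq0.
  rewrite cards_eq0 => /eqP orb0; have := in_set0 s; rewrite -orb0.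
  by case/imsetP; exists 1; rewrite ?mul1r //; apply: ring_units1.
move=> _ /imsetP[u /ring_unitsP Uu ->].
have [v [uv vu]] := Uu.
rewrite (reindex_inj (h := fun t => u * t)) /=; last first.
  by move=> x y /(congr1 (fun z => v * z)); rewrite !mulrA vu !mul1r.
apply: eq_big => [t|t _]; last by rewrite hU.
rewrite -mulrA; apply/andP/eqP => [[_ /eqP/(congr1 (fun z => v * z))]|->].
  by rewrite !mulrA vu !mul1r.
by split=> //; apply/imsetP; exists u => //; apply/ring_unitsP.
Qed.
End LeftConvolution.

(** * Diagonal entries: Poisson summation *)

Section WeightSums.
Variables (F : numFieldType) (R : finPzRingType) (chi : R -> F).
Hypothesis chi_gen : generating_character chi.

Let chi0 : chi 0 = 1. Proof. by case: chi_gen. Qed.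
Let chiD : {morph chi : x y / x + y >-> x * y}. Proof. by case: chi_gen. Qed.
Let chi_nd : forall s, (forall r, chi (r * s) = 1) -> s = 0.
Proof. by case: chi_gen. Qed.

(** The orthogonal, for the pairing [chi (r * t)], of the left annihilator of
    [s]. *)
Definition lann_perp (s : R) : {set R} :=
  [set r | [forall t, (t * s == 0) ==> (chi (r * t) == 1)]].

Lemma lann_perpP s r :
  reflect (forall t, t * s = 0 -> chi (r * t) = 1) (r \in lann_perp s).
Proof.
rewrite inE; apply: (iffP forallP) => [H t /eqP ts|H t].
  by have /implyP/(_ ts)/eqP := H t.
by apply/implyP=> /eqP/H->.
Qed.

Lemma char_oppr_eq1 x : (chi (- x) == 1) = (chi x == 1).
Proof.
have : chi x * chi (- x) = 1 by rewrite -chiD subrr.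
by move=> chixN; apply/eqP/eqP => chi1; move: chixN; rewrite chi1 ?mul1r ?mulr1.
Qed.

Lemma right_ideal_lann_perp s : right_ideal (lann_perp s).
Proof.
split; last first.
  move=> x r /lann_perpP xS; apply/lann_perpP => t ts.
  by rewrite -mulrA xS // -mulrA ts mulr0.
split=> [|x y]; first by apply/lann_perpP => t _; rewrite mul0r.
move=> /lann_perpP xS /lann_perpP yS; apply/lann_perpP => t ts.
rewrite mulrBl chiD xS // mul1r; apply/eqP.
by rewrite char_oppr_eq1 yS.
Qed.

(** The preimage of [s] under the Nakayama map is orthogonal to every [t] with
    [t * s = 0]. *)
Lemma lann_perp_neq0 s : s != 0 -> lann_perp s != [set 0].
Proof.
have [tau [tau' tauK tau'K] tauE] := nakayama_bij chi_gen.
move=> s_n0; apply/eqP=> S0.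
have : tau' s \in lann_perp s.
  by apply/lann_perpP => t ts; rewrite tauE tau'K ts.
rewrite S0 inE => /eqP s0; case/eqP: s_n0; rewrite -(tau'K s) s0.
by apply: chi_nd => x; rewrite -tauE mul0r.
Qed.

(** Poisson summation: the [t] with [t * s = s] form the coset of [1] modulo the
    left annihilator of [s], so summing Fourier coefficients over them restricts
    [w] to the orthogonal of the annihilator and twists it by [chi (- r)]. *)
Lemma sum_fourier_coset w s :
  \sum_(t | t * s == s) fourier chi w t =
    #|R|%:R^-1 * #|[set t | t * s == 0]|%:R *
      \sum_(r in lann_perp s) w r * chi (- r).
Proof.
have LZ : zmod_closed [set t | t * s == 0].
  split=> [|x y]; rewrite !inE ?mul0r // => /eqP xs /eqP ys.
  by rewrite mulrBl xs ys subrr.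
rewrite -mulr_sumr -mulrA; congr (_ * _); rewrite exchange_big /= mulr_sumr.
rewrite [RHS]big_mkcond /=; apply: eq_bigr => r _.
rewrite -mulr_sumr (reindex_inj (addrI 1)) /=.
rewrite (eq_big (fun t => t \in [set t | t * s == 0])
                (fun t => chi (- r) * chi (- (r * t)))); first last.
- by move=> t _; rewrite mulrDr mulr1 opprD chiD.
- by move=> t; rewrite inE mulrDl mul1r -subr_eq0 addrC addKr.
rewrite -mulr_sumr (sum_additive_char (psi := fun t => chi (- (r * t))) LZ) /=;
  last 2 first.
- by move=> x y _ _; rewrite mulrDr opprD chiD.
- by rewrite mulr0 oppr0.
have -> : [forall t in [set t | t * s == 0], chi (- (r * t)) == 1] =
          (r \in lann_perp s).
  rewrite inE; apply: eq_forallb => t; rewrite inE.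
  by rewrite char_oppr_eq1.
by case: ifP => _; rewrite ?mulr0 // mulrA mulrC.
Qed.
End WeightSums.

(** * Sums of a generating character over generators of ideals *)

Section PrincipalIdeals.
Variable R : finPzRingType.

Lemma principal_self (a : R) : a \in principal a.
Proof. by apply/imsetP; exists 1; rewrite ?mulr1. Qed.

Lemma principal_in (a : R) : principal a \in principals R.
Proof. exact: imset_f. Qed.

Lemma right_ideal_principal (a : R) : right_ideal (principal a).
Proof.
split=> [|_ r /imsetP[x _ ->]]; last by rewrite -mulrA imset_f.
split=> [|_ _ /imsetP[x _ ->] /imsetP[y _ ->]]; last by rewrite -mulrBr imset_f.
by apply/imsetP; exists 0; rewrite ?mulr0.
Qed.

Lemma principal_sub (S : {set R}) a : right_ideal S ->
  (principal a \subset S) = (a \in S).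
Proof.
move=> [_ SM]; apply/subsetP/idP => [/(_ a (principal_self a))//|Sa].
by move=> _ /imsetP[r _ ->]; apply: SM.
Qed.

Lemma principal0 : principal 0 = [set 0] :> {set R}.
Proof.
apply/setP=> x; rewrite inE; apply/imsetP/eqP => [[r _ ->]|->].
  by rewrite mul0r.
by exists 0; rewrite ?mulr0.
Qed.

Lemma eq_principal (a b : R) : principal a = principal b ->
  exists2 u, is_unit u & a = b * u.
Proof.
move=> ab; have /imsetP[x _ abx] : a \in principal b.
  by rewrite -ab principal_self.
have /imsetP[y _ bay] : b \in principal a by rewrite ab principal_self.
exact: same_principal_unit abx bay.
Qed.

Variables (F : numFieldType) (chi : R -> F).
Hypothesis chi_gen : generating_character chi.

Let chi0 : chi 0 = 1. Proof. by case: chi_gen. Qed.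
Let chiD : {morph chi : x y / x + y >-> x * y}. Proof. by case: chi_gen. Qed.

(** Both sides have the same sums over the principal ideals contained in [A]:
    on the left this is the sum of [chi] over [A], which is [0] for [A] nonzero
    because a generating character is not trivial on any nonzero right ideal;
    on the right it is the recursion of the Moebius function. *)
Lemma sum_generators_moebius A : A \in principals R ->
  \sum_(r | principal r == A) chi r =
    (moebius (principals R) (principal 0) A)%:~R.
Proof.
have [m] := ubnP #|A|; elim: m A => // m IHm A lt_Am PA.
have [->|A_n0] := eqVneq A (principal 0).
  rewrite moebius_refl (big_pred1 0) ?chi0 // => r.
  apply/eqP/eqP => [r0|->//]; apply/set1P.
  by rewrite -principal0 -r0 principal_self.
have [a _ defA] := imsetP PA; have idA := right_ideal_principal a.
rewrite -defA in idA.
have sub0 B : B \in principals R -> principal 0 \subset B.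
  case/imsetP=> b _ ->; have idb := right_ideal_principal b.
  by rewrite principal_sub //; case: idb => -[].
have sumA : \sum_(r in A) chi r = 0.
  rewrite (sum_additive_char (proj1 idA) (in2W chiD) chi0).
  case: ifP => // /forall_inP chi1; case/eqP: A_n0; rewrite defA; congr principal.
  apply: (right_nondegenerate chi_gen) => r; apply/eqP/chi1.
  by rewrite defA; apply: imset_f.
have split_sum (g : {set R} -> F) :
    \sum_(B in principals R | B \subset A) g B =
    g A + \sum_(B in principals R | B \proper A) g B.
  rewrite (bigD1 A) /=; last by rewrite PA subxx.
  congr (_ + _); apply: eq_bigl => B.
  by rewrite properEneq -andbA [(B != A) && _]andbC.
have : \sum_(B in principals R | B \subset A)
         \sum_(r | principal r == B) chi r = 0.
  rewrite -[RHS]sumA (partition_big (@principal R)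
    (fun B => (B \in principals R) && (B \subset A))) /=; last first.
    by move=> r Ar; rewrite principal_in principal_sub.
  apply: eq_bigr => B /andP[_ sBA]; apply: eq_bigl => r.
  by case: eqP => [rB|]; rewrite ?andbF // -(principal_sub _ idA) rB sBA.
rewrite split_sum => /eqP; rewrite addr_eq0 => /eqP->.
have lt0A : principal 0 \proper A by rewrite properEneq eq_sym A_n0 sub0.
move: (congr1 (fun z : int => z%:~R : F) (moebius_sum PA lt0A)).
rewrite (eq_bigl (fun B => (B \in principals R) && (B \subset A))); last first.
  by move=> B /=; case PB: (B \in principals R); rewrite //= sub0.
rewrite rmorph_sum split_sum /= => /eqP; rewrite addr_eq0 => /eqP->.
congr (- _); apply: eq_bigr => B /andP[PB ltBA]; apply: IHm => //.
by rewrite -ltnS; apply: leq_trans lt_Am; rewrite ltnS proper_card.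
Qed.
End PrincipalIdeals.

Section IdealWeights.
Variables (K : realType) (R : finPzRingType) (w : R -> complex K).
Hypothesis w_inv : bi_invariant w.

Lemma weightMr a u : is_unit u -> w (a * u) = w a.
Proof. by move=> Uu; rewrite -[a in LHS]mul1r w_inv //; apply: is_unit1. Qed.

Lemma ideal_weight_principal a : ideal_weight w (principal a) = w a.
Proof.
rewrite /ideal_weight; case: pickP => [b /eqP/eq_principal[u Uu ->]|].
  exact: weightMr.
by move/(_ a); rewrite eqxx.
Qed.

Variable chi : R -> complex K.
Hypothesis chi_gen : generating_character chi.

Lemma sum_weight_char (S : {set R}) : right_ideal S ->
  \sum_(r in S) w r * chi (- r) =
  \sum_(A in principals R | A \subset S)
    ideal_weight w A * (moebius (principals R) (principal 0) A)%:~R.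
Proof.
move=> idS; have [[S0 SB] _] := idS.
have SN x : (- x \in S) = (x \in S).
  have N y : y \in S -> - y \in S by rewrite -sub0r; apply: SB.
  by apply/idP/idP => [/N|/N //]; rewrite opprK.
rewrite (reindex_inj oppr_inj) /=.
rewrite (eq_big (mem S) (fun r => w r * chi r)); first last.
(* [w (- r) = w r], since [-1] is a unit. *)
- move=> r _; rewrite opprK -[in w _](mulr1 r) -mulrN weightMr //.
  by exists (-1); rewrite mulrNN mulr1.
- exact: SN.
rewrite (partition_big (@principal R)
    (fun B => (B \in principals R) && (B \subset S))) /=; last first.
  by move=> r Ar; rewrite principal_in principal_sub.
apply: eq_bigr => A /andP[PA sAS]; rewrite -(sum_generators_moebius chi_gen PA).
rewrite mulr_sumr; apply: eq_big => r.
  by case: eqP => [rB|]; rewrite ?andbF // -(principal_sub _ idS) rB sAS.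
by case/andP=> _ /eqP<-; rewrite ideal_weight_principal.
Qed.

Lemma fourierMl u t : is_unit u -> fourier chi w (u * t) = fourier chi w t.
Proof.
move=> [v [uv vu]]; have Uv : is_unit v by exists u.
rewrite /fourier; congr (_ * _).
rewrite (reindex_inj (h := fun r => r * v)) /=.
  by apply: eq_bigr => r _; rewrite weightMr // -mulrA (mulrA v) vu mul1r.
by move=> y z /(congr1 (fun a => a * u)); rewrite -!mulrA vu !mulr1.
Qed.

Hypothesis w_sums : forall S : {set R}, right_ideal S -> S != [set 0] ->
  \sum_(A in principals R | A \subset S)
    ideal_weight w A * (moebius (principals R) (principal 0) A)%:~R != 0.

(** The weight enters the extension problem only through this lemma: it trades
    [w] for the weight [a |-> \sum_u chi (a * u)], a combination of characters
    with constant coefficients.  For [z : R] put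
      [E z = \sum_u \sum_i (chi (x i * u * z) - chi (y i * u * z))].
    Expanding [w] into characters and moving the left multiplier [r] to the
    right by the Nakayama map turns the hypothesis into
      [\sum_t fourier chi w t * E (t * s) = 0] for all [s],
    the sum over units being harmless because [w] is right invariant.  This
    system is invertible, so that [E 1 = 0]. *)
Lemma unit_char_sums_eq n (x y : 'I_n -> R) :
    (forall r, \sum_i w (r * x i) = \sum_i w (r * y i)) ->
  \sum_i \sum_(u in ring_units R) chi (x i * u) =
  \sum_i \sum_(u in ring_units R) chi (y i * u).
Proof.
move=> eq_w; have [tau [tau' tauK tau'K] tauE] := nakayama_bij chi_gen.
pose D z := \sum_i (chi (x i * z) - chi (y i * z)).
pose E z := \sum_(u in ring_units R) D (u * z).
have E0 s : E s = 0.
  apply: (left_convolution_inj (h := fourier chi w)) => {s}.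
  - by move=> u t Uu; apply: fourierMl.
  - move=> u t Uu; have [v [uv vu]] := Uu.
    rewrite /E [RHS](reindex_inj (h := fun r => r * u)) /=; last first.
      by move=> a b /(congr1 (fun c => c * v)); rewrite -!mulrA uv !mulr1.
    apply: eq_big => [r|r _]; last by rewrite mulrA.
    have Ru : u \in ring_units R by apply/ring_unitsP.
    have Rv : v \in ring_units R by apply/ring_unitsP; exists u.
    apply/idP/idP => [Rr|Rru]; first exact: ring_unitsM.
    by rewrite -[r]mulr1 -uv mulrA ring_unitsM.
  - by rewrite /E big1 // => u _; rewrite /D big1 // => i _; rewrite !mulr0 subrr.
  - move=> s s_n0; rewrite (sum_fourier_coset chi_gen) mulf_neq0 //.
      rewrite mulf_neq0 ?invr_neq0 ?card_ring_neq0 //.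
      rewrite pnatr_eq0 -lt0n; apply/card_gt0P; exists 0.
      by rewrite inE mul0r.
    have S_ideal := right_ideal_lann_perp chi_gen s.
    by rewrite (sum_weight_char S_ideal) w_sums // lann_perp_neq0.
  (* With [s = tau r], the sum over [t] is that of [w (r * x i) - w (r * y i)]. *)
  move=> s; rewrite -(tau'K s); move: (tau' s) => r {s}.
  rewrite /E; under eq_bigr => t _ do rewrite mulr_sumr.
  rewrite exchange_big big1 //= => u /ring_unitsP Uu.
  rewrite /D; under eq_bigr => t _ do rewrite mulr_sumr.
  rewrite exchange_big /=.
  have w_char a :
      \sum_t fourier chi w t * chi (a * (u * (t * tau r))) = w (r * a).
    rewrite -(weightMr (r * a) Uu) [RHS](fourier_inversion chi_gen).
    by apply: eq_bigr => t _; rewrite !mulrA -tauE !mulrA.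
  under eq_bigr => i _.
    under eq_bigr => t _ do rewrite mulrBr.
    rewrite sumrB !w_char; over.
  by rewrite sumrB eq_w subrr.
apply/eqP; rewrite -subr_eq0 -sumrB -[X in _ == X](E0 1) /E; apply/eqP.
rewrite [RHS]exchange_big /=; apply: eq_bigr => i _; rewrite -sumrB.
by apply: eq_bigr => u _; rewrite mulr1.
Qed.
End IdealWeights.

(** * Matching functionals up to units *)

Section UnitOrbits.
Variables (R : finPzRingType) (T : finType).
Implicit Types mu nu : {ffun T -> R}.

(** Functionals on a code form a right module, with units acting on it. *)
Definition rscale mu (u : R) : {ffun T -> R} := [ffun x => mu x * u].

Definition unit_orbit mu : {set {ffun T -> R}} :=
  [set rscale mu u | u in ring_units R].

Definition transporter mu nu : {set R} :=
  [set u in ring_units R | rscale mu u == nu].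

Lemma in_transporter mu nu u :
  (u \in transporter mu nu) = (u \in ring_units R) && (rscale mu u == nu).
Proof. by rewrite !inE. Qed.

Lemma rscaleM mu u v : rscale (rscale mu u) v = rscale mu (u * v).
Proof. by apply/ffunP=> x; rewrite !ffunE mulrA. Qed.

Lemma rscale1 mu : rscale mu 1 = mu.
Proof. by apply/ffunP=> x; rewrite !ffunE mulr1. Qed.

Lemma unit_orbit_eq mu nu :
  (unit_orbit mu == unit_orbit nu) = (nu \in unit_orbit mu).
Proof.
have sub a b : b \in unit_orbit a -> unit_orbit b \subset unit_orbit a.
  case/imsetP=> u Uu ->; apply/subsetP=> _ /imsetP[v Uv ->].
  by rewrite rscaleM imset_f // ring_unitsM.
apply/idP/idP => [/eqP->|nu_mu].
  by apply/imsetP; exists 1; rewrite ?rscale1 //; apply: ring_units1.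
rewrite eqEsubset (sub _ _ nu_mu) andbT; apply: sub.
have [u /ring_unitsP[v [uv vu]] ->] := imsetP nu_mu.
apply/imsetP; exists v; last by rewrite rscaleM uv rscale1.
by apply/ring_unitsP; exists u.
Qed.

Lemma card_transporter mu nu : #|transporter mu nu| =
  if unit_orbit mu == unit_orbit nu then #|transporter nu nu| else 0%N.
Proof.
rewrite unit_orbit_eq; case: ifPn => [/imsetP[u Uu nuE]|nu_out]; last first.
  apply: eq_card0 => u; rewrite in_transporter.
  apply: contraNF nu_out => /andP[Uu /eqP<-].
  exact: imset_f.
have /ring_unitsP[v [uv vu]] := Uu.
have mul_u_inj : injective (fun t => u * t).
  by move=> x y /(congr1 (fun z => v * z)); rewrite !mulrA vu !mul1r.
rewrite -[RHS](card_imset _ mul_u_inj); apply: eq_card => t.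
apply/idP/imsetP => [|[s]]; rewrite !in_transporter.
  move=> /andP[Ut /eqP mut]; exists (v * t); last by rewrite mulrA uv mul1r.
  rewrite in_transporter ring_unitsM //=; last by apply/ring_unitsP; exists u.
  by rewrite [X in rscale X _]nuE rscaleM mulrA uv mul1r mut.
move=> /andP[Us /eqP nus] ->; rewrite -!rscaleM -nuE nus eqxx andbT.
exact: ring_unitsM.
Qed.

Lemma card_stabilizer_gt0 nu : (0 < #|transporter nu nu|)%N.
Proof.
by apply/card_gt0P; exists 1; rewrite in_transporter ring_units1 rscale1 /=.
Qed.

(** Each index [i] with [lam i] in the orbit of [nu] contributes the size of the
    stabilizer of [nu] to the sum, and the other indices contribute nothing.  So
    both families meet every orbit equally often, and any bijection of the
    indices that respects orbits will do. *)
Lemma unit_orbit_matching n (lam lam' : 'I_n -> {ffun T -> R}) :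
    (forall nu, nu \in codom lam ++ codom lam' ->
      \sum_i #|transporter (lam i) nu| = \sum_i #|transporter (lam' i) nu|)%N ->
  exists (s : 'S_n) (u : 'I_n -> R), (forall i, is_unit (u i)) /\
    (forall i, lam' i = rscale (lam (s i)) (u i)).
Proof.
move=> eq_sums.
have count_orbit (f : 'I_n -> {ffun T -> R}) nu :
    (\sum_i #|transporter (f i) nu| =
     count_mem (unit_orbit nu) [tuple unit_orbit (f i) | i < n] *
     #|transporter nu nu|)%N.
  rewrite (eq_bigr _ (fun i _ => card_transporter (f i) nu)) -big_mkcond /=.
  rewrite sum_nat_const; congr (_ * _)%N.
  rewrite count_map cardE /enum_mem size_filter count_filter.
  by apply: eq_count => i; rewrite /= andbT.
have /tuple_permP[s sE] : perm_eq [tuple unit_orbit (lam' i) | i < n]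
                                  [tuple unit_orbit (lam i) | i < n].
  apply/allP => A; rewrite mem_cat => A_in.
  have [nu nu_in ->] :
      exists2 nu, nu \in codom lam ++ codom lam' & A = unit_orbit nu.
    case/orP: A_in => /mapP[i _ ->]; [exists (lam' i) | exists (lam i)] => //;
      by rewrite mem_cat codom_f ?orbT.
  have := eq_sums nu nu_in; rewrite !count_orbit => /eqP.
  by rewrite eqn_pmul2r ?card_stabilizer_gt0 //= eq_sym.
have orbE i : unit_orbit (lam' i) = unit_orbit (lam (s i)).
  have := congr1 (fun t => nth set0 t i) sE.
  rewrite -!tnth_nth.
  by rewrite !tnth_mktuple.
have /fin_all_exists2[u Uu uE] : forall i,
    exists2 u, is_unit u & lam' i = rscale (lam (s i)) u.
  move=> i; have : lam' i \in unit_orbit (lam (s i)).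
    by rewrite -unit_orbit_eq orbE.
  by case/imsetP=> u /ring_unitsP Uu ->; exists u.
by exists s, u.
Qed.
End UnitOrbits.

(** The image of [1] under an isomorphism from [R] to its character module. *)
Lemma frobenius_generating (K : realType) (R : finPzRingType) :
  frobenius K R -> exists chi : R -> complex K, generating_character chi.
Proof.
case=> phi [psi phiK psiK]; pose chi := phi 1.
have chiE (s : R^o) r : phi s r = chi (r * s).
  have {1}-> : s = s *: (1 : R^o) by rewrite /GRing.scale /= mulr1.
  by rewrite linearZ /= dual_scaleE.
have chiD := charD chi.
exists chi; split=> //.
- by apply: (mulfI (char_neq0 chi 0)); rewrite -chiD addr0 mulr1.
- move=> s chi1; apply: (can_inj phiK); rewrite linear0.
  by apply: dual_eqP => r; rewrite chiE chi1 ffunE.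
move=> a.
have ax_char : is_character [ffun x => chi (a * x)].
  apply/andP; split; apply/forallP => x; first by rewrite ffunE char_neq0.
  by apply/forallP=> y; rewrite !ffunE mulrDr chiD.
exists (psi (CharDual ax_char)) => x.
by rewrite -[RHS]chiE psiK ffunE.
Qed.

(** * Characters of a code and extension of functionals *)

Section CharactersOfCodes.
Variables (F : numFieldType) (R : finPzRingType) (chi : R -> F).
Hypothesis chi_gen : generating_character chi.
Variables (n : nat) (C : {set 'rV[R]_n}).
Hypothesis C_sub : submod_closed C.
Implicit Types mu nu : 'rV[R]_n -> R.

Let chi0 : chi 0 = 1. Proof. by case: chi_gen. Qed.
Let chiD : {morph chi : x y / x + y >-> x * y}. Proof. by case: chi_gen. Qed.
Let chi_nd : forall s, (forall r, chi (r * s) = 1) -> s = 0.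
Proof. by case: chi_gen. Qed.

Definition linear_on mu : Prop :=
  forall a x y, x \in C -> y \in C -> mu (a *: x + y) = a * mu x + mu y.

Lemma linear_on0 mu : linear_on mu -> mu 0 = 0.
Proof.
move=> mu_lin; have [C0 _] := C_sub.
have := mu_lin 1 0 0 C0 C0; rewrite scale1r addr0 mul1r => /eqP.
by rewrite -[X in X == _]addr0 (inj_eq (addrI _)) eq_sym => /eqP.
Qed.

Lemma linear_onZ mu a x : linear_on mu -> x \in C -> mu (a *: x) = a * mu x.
Proof.
move=> mu_lin Cx; have [C0 _] := C_sub.
by rewrite -[a *: x]addr0 mu_lin // linear_on0 // addr0.
Qed.

(** [chi \o mu] is trivial on [C] only if [mu] vanishes there, because
    [r * mu x = mu (r *: x)] is again a value of [mu]. *)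
Lemma sum_char_code mu : linear_on mu ->
  \sum_(x in C) chi (mu x) = if [forall x in C, mu x == 0] then #|C|%:R else 0.
Proof.
move=> mu_lin; have [C0 CL] := C_sub.
have C_zmod : zmod_closed C.
  by split=> // x y Cx Cy; rewrite addrC -scaleN1r CL.
have muD : {in C &, {morph mu : x y / x + y >-> x + y}}.
  by move=> x y Cx Cy; rewrite -[x in LHS]scale1r mu_lin ?mul1r.
have mu0 := linear_on0 mu_lin.
rewrite (sum_additive_char (psi := fun x => chi (mu x)) C_zmod).
- congr (if _ then _ else _); apply/forall_inP/forall_inP => chi1 x Cx.
    apply/eqP/chi_nd => r; rewrite -linear_onZ //; apply/eqP/chi1.
    by rewrite -[_ *: _]addr0 CL.
  by rewrite (eqP (chi1 x Cx)) chi0.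
- by move=> x y Cx Cy; rewrite muD ?chiD.
- by rewrite mu0 chi0.
Qed.

(** Functionals that agree on [C] have equal restrictions; the value [0] outside
    [C] is stable under [rscale]. *)
Definition restrict mu : {ffun 'rV[R]_n -> R} :=
  [ffun x => if x \in C then mu x else 0].

(** The multiplicity of the character [chi \o nu] in a sum of characters of [C],
    read off as an inner product. *)
Lemma sum_char_transporter m (lam : 'I_m -> 'rV[R]_n -> R) nu :
    (forall i, linear_on (lam i)) -> linear_on nu ->
  \sum_(x in C) (\sum_i \sum_(u in ring_units R) chi (lam i x * u)) *
     chi (- nu x) =
  #|C|%:R * (\sum_i #|transporter (restrict (lam i)) (restrict nu)|)%:R.
Proof.
move=> lam_lin nu_lin.
rewrite natr_sum mulr_sumr.
under eq_bigr => x _ do rewrite mulr_suml.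
rewrite exchange_big /=; apply: eq_bigr => i _.
under eq_bigr => x _ do rewrite mulr_suml.
rewrite exchange_big /= mulr_natr -sumr_const.
rewrite [RHS](eq_bigl (fun u => (u \in ring_units R) &&
    (rscale (restrict (lam i)) u == restrict nu))) => [|u]; last first.
  by rewrite in_transporter.
rewrite [RHS]big_mkcondr /=; apply: eq_bigr => u _.
under eq_bigr => x _ do rewrite -chiD.
rewrite (sum_char_code (mu := fun x => lam i x * u - nu x)).
  congr (if _ then _ else _); apply/forall_inP/eqP => [eq_on|/ffunP eq_on x Cx].
    apply/ffunP=> x; rewrite !ffunE; case: ifP => [Cx|]; last by rewrite mul0r.
    exact/subr0_eq/eqP/eq_on.
  by have := eq_on x; rewrite !ffunE Cx => ->; rewrite subrr.
move=> a x y Cx Cy; rewrite lam_lin // nu_lin // mulrDl opprD addrACA.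
by rewrite mulrBr mulrA.
Qed.

Lemma linear_extension m (lam lam' : 'I_m -> 'rV[R]_n -> R) :
    (forall i, linear_on (lam i)) -> (forall i, linear_on (lam' i)) ->
    (forall x, x \in C -> \sum_i \sum_(u in ring_units R) chi (lam i x * u) =
                          \sum_i \sum_(u in ring_units R) chi (lam' i x * u)) ->
  exists (s : 'S_m) (u : 'I_m -> R), (forall i, is_unit (u i)) /\
    (forall i x, x \in C -> lam' i x = lam (s i) x * u i).
Proof.
move=> lam_lin lam'_lin eq_chi.
have [|s [u [Uu uE]]] := @unit_orbit_matching R _ m
    (fun i => restrict (lam i)) (fun i => restrict (lam' i)).
  move=> nu nu_in.
  have [nu' nu'_lin ->] : exists2 nu', linear_on nu' & nu = restrict nu'.
    move: nu_in; rewrite mem_cat => /orP[] /codomP[i ->].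
      by exists (lam i).
    by exists (lam' i).
  have cardC_neq0 : #|C|%:R != 0 :> F.
    by rewrite pnatr_eq0 -lt0n; apply/card_gt0P; exists 0; case: C_sub.
  apply/eqP; rewrite -(eqr_nat F); apply/eqP/(mulfI cardC_neq0).
  rewrite -!sum_char_transporter //; apply: eq_bigr => x Cx.
  by rewrite eq_chi.
exists s, u; split=> // i x Cx.
by have /ffunP/(_ x) := uE i; rewrite !ffunE Cx.
Qed.
End CharactersOfCodes.

Theorem corollary4p5 (K : realType) (R : finPzRingType) (w : R -> complex K)
  (hR : frobenius K R) (hw : is_weight w) (hbi : bi_invariant w)
  (hsum : forall S : {set R}, right_ideal S -> S != [set 0] ->
     \sum_(A in principals R | A \subset S)
        ideal_weight w A * (moebius (principals R) (principal 0) A)%:~R != 0) :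
  extension_property w.
Proof.
have [chi chi_gen] := frobenius_generating hR.
move=> n C f C_sub [f_lin f_inj f_weight].
have [C0 CL] := C_sub.
pose lam (i : 'I_n) (x : 'rV[R]_n) := x 0 i.
pose lam' (i : 'I_n) x := f x 0 i.
have lam_lin i : linear_on C (lam i) by move=> a x y _ _; rewrite /lam !mxE.
have lam'_lin i : linear_on C (lam' i).
  by move=> a x y Cx Cy; rewrite /lam' f_lin // !mxE.
have eq_sums x : x \in C ->
    \sum_i \sum_(u in ring_units R) chi (lam i x * u) =
    \sum_i \sum_(u in ring_units R) chi (lam' i x * u).
  move=> Cx; apply: (unit_char_sums_eq hbi chi_gen hsum
    (x := fun i => lam i x) (y := fun i => lam' i x)) => r.
  have Crx : r *: x \in C by rewrite -[_ *: _]addr0 CL.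
  have := f_weight _ Crx; rewrite /weight => /esym eq_w.
  under eq_bigr => i _ do rewrite -(linear_onZ C_sub r (lam_lin i) Cx).
  by under [RHS]eq_bigr => i _ do rewrite -(linear_onZ C_sub r (lam'_lin i) Cx).
have [s [u [Uu uE]]] := linear_extension chi_gen C_sub lam_lin lam'_lin eq_sums.
exists (fun x => \row_i (x 0 (s i) * u i)); split; first by exists s, u.
by move=> x Cx; apply/rowP => i; rewrite !mxE -uE.
Qed.
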